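(* Let $P_1,\dots,P_k$ be set partitions of $[n]$ with $3\le|P_i|\le n-1$ for all $i$ and $P_i\not\le P_j$ for all $i\neq j$. Let $Z_i$ be the atomic extremal assignment generated by the basic pair of $P_i$. Suppose that for all $i\neq j$, all $Q_i\preceq P_i$ and $Q_j\preceq P_j$ (with $|Q_i|,|Q_j|\ge3$), and every tight common upper bound $R$ of $Q_i$ and $Q_j$, there is $\ell$ with $R\le P_\ell$. Then $Z:=\bigcup_{i=1}^k Z_i$ is an extremal assignment.
   Context: $[n]=\{1,\dots,n\}$. A stable $n$-labeled tree is a finite tree with $n$ leaves labeled bijectively by $[n]$, all internal vertices of degree $\ge 3$; $V(G)$ its internal vertices; $S(n)$ the set of such trees up to label-preserving isomorphism. $G\rightsquigarrow G'$: $G'$ obtained by collapsing connected sets of internal vertices, inducing surjection $\pi:V(G)\to V(G')$; $\{v_1,\dots,v_k\}\rightsquigarrow v'$ means $\pi^{-1}(v')=\{v_1,\dots,v_k\}$. An extremal assignment of order $n$: rule $Z(G)\subset V(G)$ for $G\in S(n)$ with (a) $Z(G)\ne V(G)$, (b) if $G\rightsquigarrow G'$ and $\{v_1,\dots,v_k\}\rightsquigarrow v'$ then $v'\in Z(G')\iff v_1,\dots,v_k\in Z(G)$. Unions are vertexwise: $(\bigcup Z_i)(G)=\bigcup Z_i(G)$. Set partitions of $[n]$: $P\le Q$ iff $Q$ refines $P$; $P\preceq Q$ iff $P\le Q$ and no block of $P$ of size $\ge 2$ lies inside the union of the singleton blocks of $Q$. $R$ is a tight common upper bound of $P,Q$ if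 $P\le R$, $Q\le R$, and every block of $R$ is a block of $P$ or of $Q$. For a set partition $P$ with $3\le|P|\le n-1$, its basic pair $(G_P,v_P)$ is the tree with central internal vertex $v_P$, each singleton block's leaf adjacent to $v_P$, and for each block $B$ with $|B|\ge2$ an internal vertex adjacent to $v_P$ and exactly the leaves of $B$. The atomic extremal assignment generated by $(G_P,v_P)$ is the smallest extremal assignment $Z$ with $v_P\in Z(G_P)$; it equals $\bigcup_{Q\preceq P,|Q|\ge3}Z_Q$ where $Z_Q(H)=\{w\in V(H):\exists H\rightsquigarrow G_Q,\ w\mapsto v_Q\}$. *)

(* Defs.v *)
From mathcomp Require Import all_boot.
Set Implicit Arguments. Unset Strict Implicit. Unset Printing Implicit Defensive.

(* A candidate n-labeled tree: [nint] internal vertices 'I_nint, leaves 'I_n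
   (leaf i carries label i), and an adjacency relation on leaves + internal. *)
Definition vtx (n m : nat) : finType := ('I_n + 'I_m)%type.

Record stree (n : nat) := STree {
  nint : nat;
  adj  : rel (vtx n nint) }.
Arguments nint {n} s.
Arguments adj {n} s.

(* G is a stable n-labeled tree: a finite simple graph that is a tree
   (connected with |E| = |V| - 1), leaves have degree 1, internal vertices
   degree >= 3. *)
Definition stable {n} (G : stree n) : Prop :=
  (forall x y, adj G x y = adj G y x) /\
  (forall x, ~~ adj G x x) /\
  (forall x y, connect (adj G) x y) /\
  #|[set p : vtx n (nint G) * vtx n (nint G) | adj G p.1 p.2]|
     = (#|vtx n (nint G)| - 1).*2 /\
  (forall i : 'I_n, #|[set y | adj G (inl i) y]| = 1) /\
  (forall u : 'I_(nint G), 3 <= #|[set y | adj G (inr u) y]|).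

Definition extv n m m' (pi : 'I_m -> 'I_m') (x : vtx n m) : vtx n m' :=
  match x with inl i => inl i | inr u => inr (pi u) end.

(* G ~> G' via pi : V(G) -> V(G'): pi is surjective, its fibres are connected
   sets of internal vertices of G, and G' is (label-preservingly isomorphic to)
   the graph obtained by collapsing each fibre to one vertex. *)
Definition contraction {n} (G G' : stree n) (pi : 'I_(nint G) -> 'I_(nint G')) : Prop :=
  (forall w, exists u, pi u = w) /\
  (forall u u', pi u = pi u' ->
     connect [rel a b | adj G (inr a) (inr b) && (pi a == pi b)] u u') /\
  (forall x y : vtx n (nint G'), x != y ->
     (adj G' x y <-> exists a b, extv pi a = x /\ extv pi b = y /\ adj G a b)).

Arguments contraction {n} G G' pi.

Definition assignment n := forall G : stree n, 'I_(nint G) -> Prop.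

Definition extremal n (Z : assignment n) : Prop :=
  (forall G, stable G -> ~ (forall v, Z G v)) /\
  (forall (G G' : stree n) (pi : 'I_(nint G) -> 'I_(nint G')),
     stable G -> stable G' -> contraction G G' pi ->
     forall w, Z G' w <-> (forall v, pi v = w -> Z G v)).

Definition setpart n (P : {set {set 'I_n}}) : bool := partition P [set: 'I_n].

Definition ple n (P Q : {set {set 'I_n}}) : bool :=
  [forall B in Q, [exists C in P, B \subset C]].

Definition singU n (Q : {set {set 'I_n}}) : {set 'I_n} :=
  \bigcup_(B in Q | #|B| == 1) B.

Definition pprec n (P Q : {set {set 'I_n}}) : bool :=
  ple P Q && [forall B in P, (2 <= #|B|) ==> ~~ (B \subset singU Q)].

Definition tight_ub n (P Q R : {set {set 'I_n}}) : bool :=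
  [&& ple P R, ple Q R & [forall B in R, (B \in P) || (B \in Q)]].

Definition basic_pair n (P : {set {set 'I_n}}) (G : stree n) (c : 'I_(nint G)) : Prop :=
  stable G /\
  exists f : 'I_(nint G) -> {set 'I_n},
    (forall u, u != c -> f u \in P /\ 2 <= #|f u|) /\
    (forall u u', u != c -> u' != c -> f u = f u' -> u = u') /\
    (forall B, B \in P -> 2 <= #|B| -> exists u, u != c /\ f u = B) /\
    (forall i j : 'I_n, ~~ adj G (inl i) (inl j)) /\
    (forall i : 'I_n, adj G (inl i) (inr c) = ([set i] \in P)) /\
    (forall (i : 'I_n) u, u != c -> adj G (inl i) (inr u) = (i \in f u)) /\
    (forall u u', adj G (inr u) (inr u') =
        ((u == c) && (u' != c)) || ((u' == c) && (u != c))).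

Arguments basic_pair {n} P G c.

Definition ZQ n (Q : {set {set 'I_n}}) : assignment n :=
  fun H w => exists (G : stree n) (c : 'I_(nint G)),
    basic_pair Q G c /\
    exists pi : 'I_(nint H) -> 'I_(nint G), contraction H G pi /\ pi w = c.

Arguments ZQ {n} Q H w : rename.

Definition atomic n (P : {set {set 'I_n}}) : assignment n :=
  fun H w => exists Q, setpart Q /\ pprec Q P /\ 3 <= #|Q| /\ ZQ Q H w.

Arguments atomic {n} P H w : rename.

(* Main.v *)
Require Import Defs.
From mathcomp Require Import all_boot.
Set Implicit Arguments. Unset Strict Implicit. Unset Printing Implicit Defensive.

(** For an internal vertex w of a tree H let Part_H(w) be the partition of the
leaves into the components of H - w. Expanding the vertex of a basic pair can
only coarsen this partition, and shattering into singletons the blocks of Part_H(w)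
that are made of singletons of P gives a Q with [pprec Q P] and w in Z_Q(H). Hence w lies
in Z_P(H) iff Part_H(w) <= P, and only the condition of contraction from the
fibre to its image is not formal: if Part_H(v) <= P_i (i depending on v) for all v
in a connected set F, then Part_H(F) <= P_l for some l. This is proved by growing a
connected S inside F by an adjacent vertex v: Part_H(S) and Part_H(v) each have
one block covering the far side of the edge, so their common refinement
Part_H(S + v) is tight. Condition (a) is the case where F consists of all internal
vertices: Part_H(F) is then discrete, hence so is P_l, against |P_l| < n. *)

(** * Deletion of vertices and bridges in finite graphs *)

(** Deletion keeps the vertex type and only removes edges, so a vertex of [S] survives as an
    isolated point, connected to itself alone. *)
Definition del (V : finType) (g : rel V) (S : {set V}) (a b : V) :=
  [&& g a b, a \notin S & b \notin S].
Arguments del {V} g S a b /.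

Definition cut (V : finType) (g : rel V) (x y a b : V) :=
  g a b && ~~ ((a == x) && (b == y) || (a == y) && (b == x)).
Arguments cut {V} g x y a b /.

Section Graph.
Variable V : finType.
Implicit Types (g r : rel V) (S : {set V}) (x y z : V).



(** Acyclicity, in the form the later arguments use: removing any edge separates its ends. *)
Definition bridges g : Prop := forall x y, g x y -> ~~ connect (cut g x y) x y.

(** An edge may go to a path, possibly of length zero. This serves inclusions of relations
    ([h := id]) as well as maps that collapse edges. *)
Lemma connect_homo (W : finType) (r : rel V) (r' : rel W) (h : V -> W) x y :
  (forall a b, r a b -> connect r' (h a) (h b)) ->
  connect r x y -> connect r' (h x) (h y).
Proof.
move=> hr /connectP[p pP ->{y}].
elim: p x pP => [|z p IH] x /=; first by rewrite connect0.
by case/andP=> /hr xz /IH; apply: connect_trans.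
Qed.

Lemma connect_inv (r : rel V) (p : pred V) x y :
  (forall a b, r a b -> p a -> p b) -> connect r x y -> p x -> p y.
Proof.
move=> hr /connectP[q qP ->{y}].
elim: q x qP => [|z q IH] x //= /andP[xz zq] px.
by apply: IH zq _; apply: hr xz px.
Qed.

Lemma connect_restrict (r r' : rel V) x y :
  (forall a b, connect r x a -> connect r x b -> r a b -> r' a b) ->
  connect r x y -> connect r' x y.
Proof.
move=> hr /connectP[p pP ->{y}].
suff gen q a : connect r x a -> path r a q -> connect r' a (last a q).
  by apply: gen pP; apply: connect0.
elim: q a => [|z q IH] a xa /=; first by rewrite connect0.
case/andP=> az zq; have xz := connect_trans xa (connect1 az).
exact: connect_trans (connect1 (hr _ _ xa xz az)) (IH _ xz zq).
Qed.

Lemma sub_del g g' S S' : subrel g g' -> S' \subset S ->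
  subrel (connect (del g S)) (connect (del g' S')).
Proof.
move=> sg /subsetP sS x y; apply: (connect_homo (h := id)) => a b /and3P[ab aS bS].
by apply: connect1; rewrite /= (sg _ _ ab) !(contra (@sS _)).
Qed.

Lemma connect_del_in g S x y : x \in S -> connect (del g S) x y -> y = x.
Proof.
move=> xS; case/connectP=> -[|z p] //= /andP[/and3P[_]].
by rewrite xS.
Qed.

Lemma del_sym g S : symmetric g -> symmetric (del g S).
Proof. by move=> gs x y /=; rewrite gs [_ && (y \notin S)]andbC. Qed.

Lemma cut_sym g x y : symmetric g -> symmetric (cut g x y).
Proof.
move=> gs a b /=; rewrite gs; congr (_ && ~~ _).
by rewrite orbC ![(_ == x) && _]andbC.
Qed.

Lemma connect_eqv g : symmetric g -> equivalence_rel (connect g).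
Proof.
move=> gs x y z; split=> [|xy]; first exact: connect0.
exact: same_connect (sym_connect_sym gs) _ _ xy z.
Qed.

Lemma exit_edge r S a b : connect r a b -> a \in S -> b \notin S ->
  exists x y, [/\ r x y, x \in S & y \notin S].
Proof.
move=> ab aS bS.
have [/existsP[x /existsP[y /and3P[xy xS yS]]]|no] :=
  boolP [exists x, exists y, [&& r x y, x \in S & y \notin S]].
  by exists x, y.
case/negP: bS; apply: (connect_inv (p := [in S]) _ ab aS) => x y xy xS /=.
apply: contraR no => yS; apply/existsP; exists x; apply/existsP; exists y.
by rewrite xy xS.
Qed.

(** Grow a vertex set from one point along edges that leave it: each new vertex brings at least the
    two orientations of one new edge. *)
Lemma connected_card g : symmetric g -> (forall x y, connect g x y) ->
  (#|V| - 1).*2 <= #|[set p : V * V | g p.1 p.2]|.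
Proof.
move=> gs gc.
have grow k : k < #|V| -> exists S, #|S| = k.+1 /\
    k.*2 <= #|[set p : V * V | [&& g p.1 p.2, p.1 \in S & p.2 \in S]]|.
  elim: k => [/card_gt0P[x _]|k IH kV]; first by exists [set x]; rewrite cards1.
  have [S [cS le]] := IH (ltnW kV).
  have [a aS] : exists a, a \in S by apply/card_gt0P; rewrite cS.
  have [b] : exists b, b \in ~: S.
    by apply/card_gt0P; rewrite cardsCs setCK cS subn_gt0.
  rewrite inE => bS; have [x [y [xy xS yS]]] := exit_edge (gc a b) aS bS.
  exists (y |: S); split; first by rewrite cardsU1 yS cS.
  set A := [set p | _] in le; set B := [set p | _].
  have xyA : (x, y) \notin A by rewrite inE /= (negPf yS) !andbF.
  have yxA : (y, x) \notin (x, y) |: A.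
    rewrite !inE /= (negPf yS) !andbF orbF xpair_eqE.
    by apply: contraNN yS => /andP[/eqP-> _].
  suff sB : (y, x) |: ((x, y) |: A) \subset B.
    have := subset_leq_card sB.
    rewrite !cardsU1 yxA xyA doubleS; apply: leq_trans.
    by rewrite add1n add1n !ltnS.
  apply/subsetP=> p; rewrite !inE => /or3P[/eqP->|/eqP->|/and3P[->->->]] /=.
  - by rewrite gs xy eqxx xS orbT.
  - by rewrite xy eqxx xS !orbT.
  - by rewrite !orbT.
case: (posnP #|V|) => [->//|V0].
have [|S [_ le]] := grow (#|V| - 1); first by rewrite subn1 prednK.
apply: leq_trans le _; apply: subset_leq_card; apply/subsetP=> p.
by rewrite !inE => /andP[].
Qed.

(** An edge that is not a bridge could be cut without losing connectedness, leaving fewer edges than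
    [connected_card] allows. *)
Lemma tree_bridges g : symmetric g -> (forall x y, connect g x y) ->
  #|[set p : V * V | g p.1 p.2]| = (#|V| - 1).*2 -> bridges g.
Proof.
move=> gs gc cg x y xy; apply/negP => cxy.
have cs := cut_sym x y gs.
have cc a b : connect (cut g x y) a b.
  apply: (connect_homo (h := id)) (gc a b) => {}a {}b ab.
  have [|] := boolP ((a == x) && (b == y) || (a == y) && (b == x)).
    case/orP=> /andP[/eqP-> /eqP->] //.
    by rewrite (sym_connect_sym cs).
  by move=> nab; rewrite connect1 //= ab nab.
have := connected_card cs cc; rewrite leqNgt -cg => /negP[].
apply: proper_card; apply/properP; split.
  by apply/subsetP=> p; rewrite !inE => /andP[].
by exists (x, y); rewrite !inE /= ?xy ?eqxx.
Qed.

(** * Branches of a tree at a vertex *)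

Section Tree.
Variable g : rel V.
Hypotheses (gs : symmetric g) (gi : irreflexive g) (gb : bridges g).

(** A path from [x] to [y] avoiding [w], closed up by the edge from [y] to [w], would be a detour
    around the bridge from [w] to [x]. *)
Lemma nbrs_separated w x y : g w x -> g w y -> x != y ->
  ~~ connect (del g [set w]) x y.
Proof.
move=> wx wy xy; apply/negP => cxy; case/negP: (gb wx).
rewrite (sym_connect_sym (cut_sym _ _ gs)).
apply: (@connect_trans _ _ y).
  apply: (connect_homo (h := id)) cxy => a b /and3P[ab]; rewrite !inE => aw bw.
  by rewrite connect1 //= ab (negPf aw) (negPf bw) andbF.
rewrite connect1 //= gs wy (eq_sym y x) (negPf xy) orbF.
by apply: contraTN wx => /andP[_ /eqP<-]; rewrite gi.
Qed.

(** Induction on the size of the branch at [x]: if [x] is not in [L], step to a neighbour [y] other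
    than [w]. The branch of [y] away from [x] misses [w], so it lies in the branch of [x], and it no
    longer contains [x]. *)
Lemma leaf_beyond (L : pred V) w x :
  (forall z, ~~ L z -> 1 < #|[set y | g z y]|) -> g w x ->
  exists2 l, L l & connect (del g [set w]) x l.
Proof.
move=> deg.
have [k le] := ubnP #|[set z | connect (del g [set w]) x z]|.
elim: k => // k IH in w x le * => wx.
have [Lx|/deg Lx] := boolP (L x); first by exists x.
have [y xy yw] : exists2 y, g x y & y != w.
  case/card_gt1P: Lx => a [b [+ + ab]]; rewrite !inE => xa xb.
  have [aw|aw] := eqVneq a w; last by exists a.
  by exists b => //; rewrite -aw eq_sym.
have xNw : x != w by apply: contraTN wx => /eqP->; rewrite gi.
have nyw := nbrs_separated xy (etrans (gs x w) wx) yw.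
have sub z : connect (del g [set x]) y z -> connect (del g [set w]) x z.
  move=> yz; apply: (@connect_trans _ _ y).
    by rewrite connect1 //= xy !inE xNw.
  apply: (connect_restrict _ yz) => a b ya yb /and3P[/= -> _ _] /=.
  by rewrite !inE; apply/andP; split; apply: contraNN nyw => /eqP<-.
have [|l Ll yl] := IH x y _ xy; last by exists l => //; apply: sub.
rewrite -ltnS; apply: leq_trans le; rewrite ltnS.
apply: proper_card; apply/properP; split.
  by apply/subsetP=> z; rewrite !inE; apply: sub.
exists x; rewrite !inE ?connect0 //.
rewrite (sym_connect_sym (del_sym _ gs)); apply/negP.
by move=> /(connect_del_in (set11 x)) yx; rewrite yx gi in xy.
Qed.

Lemma three_leaves (L : pred V) w :
  (forall z, ~~ L z -> 2 < #|[set y | g z y]|) -> ~~ L w ->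
  exists l1 l2 l3, [/\ L l1, L l2 & L l3] /\
    [/\ ~~ connect (del g [set w]) l1 l2, ~~ connect (del g [set w]) l2 l3
      & ~~ connect (del g [set w]) l3 l1].
Proof.
move=> deg /deg /card_gt2P[x [y [z [[]]]]]; rewrite !inE => wx wy wz [xy yz zx].
have deg' t : ~~ L t -> 1 < #|[set y | g t y]| by move/deg/ltnW.
have [l1 L1 x1] := leaf_beyond deg' wx.
have [l2 L2 x2] := leaf_beyond deg' wy.
have [l3 L3 x3] := leaf_beyond deg' wz.
have sy := sym_connect_sym (del_sym [set w] gs).
have sep a b l l' : g w a -> g w b -> a != b -> connect (del g [set w]) a l ->
    connect (del g [set w]) b l' -> ~~ connect (del g [set w]) l l'.
  move=> wa wb ab al bl; apply: contra (nbrs_separated wa wb ab) => ll.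
  by apply: connect_trans al (connect_trans ll _); rewrite sy.
by exists l1, l2, l3; split; split=> //;
  [apply: sep xy x1 x2 | apply: sep yz x2 x3 | apply: sep zx x3 x1].
Qed.
End Tree.
End Graph.

(** * Partitions and equivalence relations on the leaves *)

Section Partitions.
Variable n : nat.
Implicit Types (e : rel 'I_n) (P Q R : {set {set 'I_n}}) (x y z : 'I_n).

Definition part e := equivalence_partition e [set: 'I_n].

Definition coarse e P : Prop :=
  forall B x y, B \in P -> x \in B -> y \in B -> e x y.

(** A form of [3 <= #|part e|] that passes at once to finer relations. *)
Definition three_classes e : Prop :=
  exists x y z, [/\ ~~ e x y, ~~ e y z & ~~ e z x].

Lemma eqv_refl e x : equivalence_rel e -> e x x.
Proof. by case/(_ x x x). Qed.

Lemma eqv_class e x y : equivalence_rel e -> e x y ->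
  [set z | e x z] = [set z | e y z].
Proof. by move=> ee xy; apply/setP=> z; rewrite !inE ((ee x y z).2 xy). Qed.

Lemma setpart_part e : equivalence_rel e -> setpart (part e).
Proof. by move=> ee; apply: equivalence_partitionP => x y z _ _ _; apply: ee. Qed.

Lemma class_in_part e x : [set y | e x y] \in part e.
Proof.
apply/imsetP; exists x; rewrite ?inE //.
by apply/setP=> y; rewrite !inE.
Qed.

Lemma partP e B : reflect (exists x, B = [set y | e x y]) (B \in part e).
Proof.
apply: (iffP idP) => [/imsetP[x _ ->]|[x ->]]; last exact: class_in_part.
by exists x; apply/setP=> y; rewrite !inE.
Qed.

Lemma ple_part e P : equivalence_rel e -> setpart P ->
  reflect (coarse e P) (ple (part e) P).
Proof.
move=> ee /and3P[_ _ P0]; apply: (iffP forall_inP) => [le B x y BP xB yB|c B BP].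
  have /exists_inP[C /partP[z ->] /subsetP sB] := le B BP.
  have := sB x xB; have := sB y yB; rewrite !inE => zy zx.
  by rewrite -((ee z x y).2 zx).
have [x xB] : exists x, x \in B by apply/set0Pn; apply: contraNneq P0 => <-.
apply/exists_inP; exists [set y | e x y]; first exact: class_in_part.
by apply/subsetP=> y yB; rewrite inE; apply: c BP xB yB.
Qed.

Lemma in_singU P x : (x \in singU P) = ([set x] \in P).
Proof.
apply/bigcupP/idP => [[B /andP[BP /cards1P[y eB]]]|xP].
  by rewrite eB inE => /eqP->; rewrite -eB.
by exists [set x]; rewrite ?set11 // xP cards1.
Qed.

Lemma card_part e : equivalence_rel e -> three_classes e -> 2 < #|part e|.
Proof.
move=> ee [x [y [z [xy yz zx]]]]; apply/card_gt2P.
exists [set t | e x t], [set t | e y t], [set t | e z t].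
split; first by split; apply: class_in_part.
have ne a b : ~~ e a b -> [set t | e a t] != [set t | e b t].
  by apply: contraNneq => /setP/(_ b); rewrite !inE (eqv_refl _ ee).
by split; apply: ne.
Qed.

(* Passing from [e] to [shatter P e] improves [ple] to [pprec]. *)
Definition shatter P e x y :=
  (x == y) || e x y && ~~ ([set z | e x z] \subset singU P).

Lemma shatter_eqv P e : equivalence_rel e -> equivalence_rel (shatter P e).
Proof.
move=> ee x y z; split; first by rewrite /shatter eqxx.
rewrite /shatter; case: eqP => [->//|_] /= /andP[xy ns].
rewrite -(eqv_class ee xy) (negPf ns) !andbT -((ee x y z).2 xy).
(* The common class of [x] and [y] is not shattered, so the equality disjuncts on both sides are
   absorbed by [e]. *)
suff sub a : e x a -> (a == z) || e x z = e x z.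
  by rewrite !sub // (eqv_refl _ ee).
by move=> xa; case: eqP => //= <-; rewrite xa.
Qed.

Lemma shatter_sub P e : equivalence_rel e -> subrel (shatter P e) e.
Proof. by move=> ee x y /orP[/eqP->|/andP[]//]; apply: eqv_refl. Qed.

Lemma shatter_class P e x : equivalence_rel e ->
  [set y | shatter P e x y] =
    if [set y | e x y] \subset singU P then [set x] else [set y | e x y].
Proof.
move=> ee; rewrite /shatter; case: ifP => _; apply/setP=> y; rewrite !inE.
  by rewrite andbF orbF eq_sym.
by rewrite andbT; case: eqP => // <-; rewrite (eqv_refl _ ee).
Qed.

Lemma setpart_disjoint P B C x :
  setpart P -> B \in P -> C \in P -> x \in B -> x \in C -> B = C.
Proof.
case/and3P=> _ tP _ BP CP xB xC.
by rewrite -(def_pblock tP BP xB) -(def_pblock tP CP xC).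
Qed.

(** Shattering cannot split a block of [P]: a point of a shattered class is a singleton block of
    [P], so its block contains no second point. *)
Lemma coarse_shatter P e : setpart P -> coarse e P -> coarse (shatter P e) P.
Proof.
move=> sP c B x y BP xB yB; rewrite /shatter; case: eqVneq => //= xy.
rewrite (c B x y BP xB yB) /=; apply/negP => /subsetP/(_ x).
rewrite !inE (c B x x BP xB xB) in_singU => /(_ isT) xP; case/negP: xy.
by rewrite (setpart_disjoint sP BP xP xB (set11 x)) inE eq_sym in yB.
Qed.

Lemma pprec_shatter P e : equivalence_rel e -> setpart P -> coarse e P ->
  pprec (part (shatter P e)) P.
Proof.
move=> ee sP c; apply/andP; split.
  by apply/ple_part => //; [apply: shatter_eqv | apply: coarse_shatter].
apply/forall_inP=> B /partP[x ->]; rewrite shatter_class //.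
by case: ifP => [_|/negbT ns]; rewrite ?cards1 //; apply/implyP.
Qed.

Lemma three_classes_sub e e' : subrel e' e -> three_classes e -> three_classes e'.
Proof.
move=> se [x [y [z [xy yz zx]]]].
by exists x, y, z; split; [apply: contra xy | apply: contra yz | apply: contra zx];
  apply: se.
Qed.

Section Merge.
Variables (k : nat) (P : 'I_k -> {set {set 'I_n}}).
Hypothesis hP : forall i, setpart (P i).
Hypothesis htub : forall i j, i != j ->
  forall Qi Qj, setpart Qi -> setpart Qj -> pprec Qi (P i) -> pprec Qj (P j) ->
  3 <= #|Qi| -> 3 <= #|Qj| ->
  forall R, setpart R -> tight_ub Qi Qj R -> exists l, ple R (P l).

(* If the side of [A] merged into one class is made of singletons of the
   partition, the meet is already coarser than it; otherwise that side survives
   shattering, so that the meet of the shattered relations is tight. *)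
Lemma coarse_meet (A : {set 'I_n}) e1 e2 i j :
  equivalence_rel e1 -> equivalence_rel e2 ->
  three_classes e1 -> three_classes e2 ->
  coarse e1 (P i) -> coarse e2 (P j) ->
  (forall x y, e1 x y -> (x \in A) = (y \in A)) ->
  (forall x y, e2 x y -> (x \in A) = (y \in A)) ->
  (forall x y, x \notin A -> y \notin A -> e1 x y) ->
  (forall x y, x \in A -> y \in A -> e2 x y) ->
  exists l, coarse (fun x y => e1 x y && e2 x y) (P l).
Proof.
move=> q1 q2 t1 t2 c1 c2 A1 A2 o1 o2.
have single B x y l : [set x] \in P l -> B \in P l -> x \in B -> y \in B -> x = y.
  move=> xP BP xB; rewrite (setpart_disjoint (hP l) BP xP xB (set11 x)) inE.
  by move/eqP.
have [eij|nij] := eqVneq i j.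
  by exists i => B x y BP xB yB; rewrite (c1 B) //= (c2 B) // -eij.
(* If the complement of [A] consists of singletons of [P i], any block of [P i] with two points lies
   in [A], where [e2] relates everything. The next case is the mirror image. *)
have [/subsetP s1|n1] := boolP (~: A \subset singU (P i)).
  exists i => B x y BP xB yB; have xy := c1 B x y BP xB yB; rewrite xy /=.
  have [xA|xA] := boolP (x \in A); first by apply: o2; rewrite // -(A1 _ _ xy).
  have := s1 x; rewrite inE in_singU => /(_ xA) /single/(_ BP xB yB) <-.
  exact: eqv_refl.
have [/subsetP s2|n2] := boolP (A \subset singU (P j)).
  exists j => B x y BP xB yB; have xy := c2 B x y BP xB yB; rewrite xy andbT.
  have [xA|xA] := boolP (x \in A); last by apply: o1; rewrite // -(A2 _ _ xy).
  have := s2 x xA; rewrite in_singU => /single/(_ BP xB yB) <-.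
  exact: eqv_refl.
pose r1 := shatter (P i) e1; pose r2 := shatter (P j) e2.
pose r x y := r1 x y && r2 x y.
have er1 : equivalence_rel r1 by apply: shatter_eqv.
have er2 : equivalence_rel r2 by apply: shatter_eqv.
have er : equivalence_rel r.
  move=> x y z; split; first by rewrite /r (eqv_refl _ er1) (eqv_refl _ er2).
  by case/andP=> xy1 xy2; rewrite /r ((er1 x y z).2 xy1) ((er2 x y z).2 xy2).
have s1 : subrel r1 e1 by apply: shatter_sub.
have s2 : subrel r2 e2 by apply: shatter_sub.
(* On [A] the relation [e2] has the single class [A], which [n2] saves from shattering, so there the
   meet is just [r1]. Outside [A] it is [r2] in the same way, and every block of the meet is a block
   of one of the two. *)
have rA x y : x \in A -> r x y = r1 x y.
  move=> xA; rewrite /r; case: (boolP (r1 x y)) => //= /s1 /A1.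
  rewrite xA => /esym yA; rewrite /r2 /shatter o2 //=.
  suff -> : [set z | e2 x z] = A by rewrite n2 orbT.
  apply/setP=> z; rewrite inE; apply/idP/idP => [/A2 <-//|]; exact: o2.
have rAC x y : x \notin A -> r x y = r2 x y.
  move=> xA; rewrite /r andbC; case: (boolP (r2 x y)) => //= /s2 /A2.
  rewrite (negPf xA) => /esym/negbT yA; rewrite /r1 /shatter o1 //=.
  suff -> : [set z | e1 x z] = ~: A by rewrite n1 orbT.
  apply/setP=> z; rewrite !inE; apply/idP/idP => [/A1 <-//|]; exact: o1.
have cr e : equivalence_rel e -> subrel r e -> coarse e (part r).
  move=> ee sr B x y /partP[z ->]; rewrite !inE => zx zy.
  by apply: sr; rewrite -((er z x y).2 zx).
have [l le] : exists l, ple (part r) (P l).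
  apply: (htub nij (Qi := part r1) (Qj := part r2)); try exact: setpart_part.
  - exact: pprec_shatter.
  - exact: pprec_shatter.
  - by apply: card_part er1 (three_classes_sub s1 t1).
  - by apply: card_part er2 (three_classes_sub s2 t2).
  have sr := setpart_part er.
  apply/and3P; split; try (apply/ple_part => //; apply: cr => // x y).
  - by case/andP.
  - by case/andP.
  apply/forall_inP=> B /partP[x ->]; have [xA|xA] := boolP (x \in A).
    rewrite (_ : [set y | r x y] = [set y | r1 x y]) ?class_in_part //.
    by apply/setP=> y; rewrite !inE rA.
  rewrite (_ : [set y | r x y] = [set y | r2 x y]) ?class_in_part ?orbT //.
  by apply/setP=> y; rewrite !inE rAC.
exists l => B x y BP xB yB.
have /ple_part -/(_ er (hP l)) c := le.
by have /andP[/s1-> /s2->] := c B x y BP xB yB.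
Qed.
End Merge.
End Partitions.

(** * Growing connected sets in a stable tree *)

Section StableTree.
Variables (n : nat) (G : stree n).
Hypotheses (hn : 3 <= n) (sG : stable G).
Implicit Types (S F : {set vtx n (nint G)}).
Local Notation g := (adj G).

Definition lcon S (i j : 'I_n) := connect (del g S) (inl i) (inl j).

Lemma adj_sym : symmetric g. Proof. by case: sG. Qed.
Lemma adj_irr : irreflexive g.
Proof. by case: sG => _ [gi _] x; apply: negPf. Qed.
Lemma adj_connect x y : connect g x y. Proof. by case: sG => _ [_ []]. Qed.
Lemma adj_bridges : bridges g.
Proof.
apply: tree_bridges adj_sym adj_connect _.
by case: sG => _ [_ [_ []]].
Qed.

Lemma del_connect_sym S : connect_sym (del g S).
Proof. exact: sym_connect_sym (del_sym _ adj_sym). Qed.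

Lemma lcon_eqv S : equivalence_rel (lcon S).
Proof. by move=> x y z; apply: (connect_eqv (del_sym S adj_sym)). Qed.

Lemma lcon_sub S S' : S' \subset S -> subrel (lcon S) (lcon S').
Proof. by move=> sS x y; apply: sub_del. Qed.

Lemma leaf_parent : exists p : 'I_n -> 'I_(nint G),
  forall i y, g (inl i) y = (y == inr (p i)).
Proof.
have deg1 i : exists y, forall z, g (inl i) z = (z == y).
  have /eqP/cards1P[y ey] : #|[set y | g (inl i) y]| = 1.
    by case: sG => _ [_ [_ [_ []]]].
  by exists y => z; move/setP/(_ z): ey; rewrite !inE.
have par i : exists u, g (inl i) (inr u).
  have [[j|u] ei] := deg1 i; last by exists u; rewrite ei.
  have ij : g (inl i) (inl j) by rewrite ei.
  have [t ej] := deg1 j.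
  have et : inl i = t by apply/eqP; rewrite -ej adj_sym.
  (* Two adjacent leaves would form a whole component, but [n >= 3] supplies a third leaf. *)
  have [l] : exists l, l \in ~: [set i; j].
    apply/card_gt0P; rewrite cardsCs setCK card_ord subn_gt0.
    by apply: leq_ltn_trans hn; rewrite cards2; case: (_ != _).
  rewrite !inE => /norP[li lj].
  pose p := fun x : vtx n (nint G) => (x == inl i) || (x == inl j).
  have cl a b : g a b -> p a -> p b.
    move=> ab /orP[] /eqP ea; move: ab; rewrite ea ?ei ?ej => /eqP->; rewrite /p.
      by rewrite eqxx orbT.
    by rewrite -et eqxx.
  have := connect_inv cl (adj_connect (inl i) (inl l)).
  by rewrite /p eqxx !(inj_eq inl_inj) (negPf li) (negPf lj) => /(_ isT).
exists (fun i => xchoose (par i)) => i y.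
have [z ez] := deg1 i; rewrite ez; congr (_ == _).
by apply/esym/eqP; rewrite -ez; apply: (xchooseP (par i)).
Qed.

Lemma lcon_three_classes S w : inr w \in S -> three_classes (lcon S).
Proof.
move=> wS; apply: (@three_classes_sub _ (lcon [set inr w])).
  by apply: lcon_sub; rewrite sub1set.
pose L := fun x : vtx n (nint G) => if x is inl _ then true else false.
have [||x [y [z [[]]]]] :=
    @three_leaves _ g adj_sym adj_irr adj_bridges L (inr w).
- by case=> // u _; case: sG => _ [_ [_ [_ []]]].
- by [].
case: x => // x; case: y => // y; case: z => // z _ _ _.
by exists x, y, z.
Qed.

Definition inside S : rel (vtx n (nint G)) :=
  fun a b => [&& g a b, a \in S & b \in S].

Definition connected_set S := {in S &, forall a b, connect (inside S) a b}.

Section Merge.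
Variables (k : nat) (P : 'I_k -> {set {set 'I_n}}).
Hypothesis hP : forall i, setpart (P i).
Hypothesis htub : forall i j, i != j ->
  forall Qi Qj, setpart Qi -> setpart Qj -> pprec Qi (P i) -> pprec Qj (P j) ->
  3 <= #|Qi| -> 3 <= #|Qj| ->
  forall R, setpart R -> tight_ub Qi Qj R -> exists l, ple R (P l).

(** The edge from [s] to [v] is a bridge with [S] on the side of [s]. Hence deleting [S] leaves the
    side of [v] connected and deleting [v] leaves the side of [s] connected, which is the input of
    [coarse_meet] with [A] the leaves on the side of [s]. *)
Lemma coarse_add S s v i j :
  connected_set S -> inr s \in S -> inr v \notin S -> g (inr s) (inr v) ->
  coarse (lcon S) (P i) -> coarse (lcon [set inr v]) (P j) ->
  exists l, coarse (lcon (inr v |: S)) (P l).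
Proof.
move=> cS sS vS sv c1 c2; pose c := cut g (inr s) (inr v).
have cs : connect_sym c := sym_connect_sym (cut_sym _ _ adj_sym).
have nsv : ~~ connect c (inr s) (inr v) := adj_bridges sv.
have sides z : connect c (inr v) z = ~~ connect c (inr s) z.
  have : connect c (inr s) z || connect c (inr v) z.
    apply: (connect_inv (p := fun z => connect c (inr s) z || connect c (inr v) z)
             _ (adj_connect (inr s) z)); last by rewrite connect0.
    move=> a b ab.
    have [|nab] := boolP ((a == inr s) && (b == inr v) || (a == inr v) && (b == inr s)).
      by case/orP=> /andP[/eqP-> /eqP->]; rewrite !connect0 ?orbT.
    have cab : connect c a b by rewrite connect1 // /c /cut ab.
    by case/orP=> h; rewrite (connect_trans h cab) ?orbT.
  case: (boolP (connect c (inr s) z)) => //= sz _; apply: contraNF nsv => vz.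
  by apply: connect_trans sz _; rewrite cs.
have sub1 a b : connect (del g S) a b -> connect c a b.
  apply: (connect_homo (h := id)) => {}a {}b /and3P[ab aS bS].
  rewrite connect1 // /c /cut ab /=; apply/norP; split.
    by apply: contra aS => /andP[/eqP->].
  by apply: contra bS => /andP[_ /eqP->].
have sub2 a b : connect (del g [set inr v]) a b -> connect c a b.
  apply: (connect_homo (h := id)) => {}a {}b; rewrite /= !inE => /and3P[ab aS bS].
  by rewrite connect1 // /c /cut ab (negPf aS) (negPf bS) andbF.
have inS z : z \in S -> connect c (inr s) z.
  move=> /(cS _ _ sS); apply: (connect_homo (h := id)) => a b /and3P[ab aS bS].
  rewrite connect1 // /c /cut ab /=; apply/norP; split.
    by apply: contraNN vS => /andP[_ /eqP<-].
  by apply: contraNN vS => /andP[/eqP<-].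
pose A := [set x | connect c (inr s) (inl x)].
have cross x y : connect c (inl x) (inl y) -> (x \in A) = (y \in A).
  by move=> xy; rewrite !inE (same_connect_r cs xy).
have [||||||l cl] := coarse_meet hP htub (A := A) (lcon_eqv S)
    (lcon_eqv [set inr v]) _ _ c1 c2 _ _.
- exact: lcon_three_classes sS.
- exact: lcon_three_classes (set11 _).
- by move=> x y /sub1/cross.
- by move=> x y /sub2/cross.
- move=> x y; rewrite !inE -!sides => vx vy.
  have xy : connect c (inl x) (inl y).
    by apply: connect_trans vy; rewrite cs.
  apply: (connect_restrict _ xy) => a b xa xb /andP[/= -> _] /=.
  by apply/andP; split; apply/negP=> /inS; apply/negP; rewrite -sides;
    apply: connect_trans vx _.
- move=> x y; rewrite !inE => vx vy.
  have xy : connect c (inl x) (inl y).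
    by apply: connect_trans vy; rewrite cs.
  apply: (connect_restrict _ xy) => a b xa xb /andP[/= -> _] /=; rewrite !inE.
  by apply/andP; split; apply: contraNneq nsv => <-; apply: connect_trans vx _.
(* The meet is contained in [lcon (inr v |: S)]: from a leaf on the side of [s], a path avoiding [S]
   cannot cross to [v]; from a leaf on the other side, a path avoiding [v] cannot reach [S]. *)
exists l => B x y BP xB yB; have /andP[l1 l2] := cl B x y BP xB yB.
have [xA|xA] := boolP (x \in A); rewrite inE in xA.
  apply: (connect_restrict _ l1) => a b xa xb /and3P[/= -> aS bS] /=.
  rewrite !inE !negb_or aS bS !andbT; apply/andP; split;
    apply: contraNneq nsv => <-; apply: connect_trans xA _; exact: sub1.
rewrite -sides in xA.
apply: (connect_restrict _ l2) => a b xa xb /and3P[/= ->]; rewrite !inE !negb_or.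
move=> -> -> /=; apply/andP; split; apply/negP=> /inS; apply/negP;
  rewrite -sides; apply: connect_trans xA _; exact: sub2.
Qed.

Lemma coarse_connected F v0 :
  connected_set F -> inr v0 \in F -> (forall i, inl i \notin F) ->
  (forall v, inr v \in F -> exists i, coarse (lcon [set inr v]) (P i)) ->
  exists l, coarse (lcon F) (P l).
Proof.
move=> cF v0F Fl hF.
(* Induction on the number of vertices of [F] still missing from [S]; the next one is the far end of
   an edge of [F] leaving [S], and it is internal because [F] contains no leaf. *)
suff grow m S : #|F :\: S| < m -> S \subset F -> inr v0 \in S ->
    connected_set S -> (exists i, coarse (lcon S) (P i)) ->
    exists i, coarse (lcon F) (P i).
  apply: (grow _ [set inr v0] (ltnSn _)); rewrite ?sub1set ?set11 //.
    by move=> a b /set1P-> /set1P->; apply: connect0.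
  exact: hF.
elim: m S => // m IH S le SF v0S cS [i ci].
have [FS|/subsetPn[b bF bS]] := boolP (F \subset S).
  by exists i; rewrite (_ : F = S) //; apply/eqP; rewrite eqEsubset FS.
have [x [y [/and3P[xy xF yF] xS yS]]] := exit_edge (cF _ _ v0F bF) v0S bS.
case: x xy xF xS => [t _ /idPn[]//|s] sy sF sS.
case: y sy yF yS => [t _ /idPn[]//|v] sv vF vS.
have [j cj] := hF v vF.
have [l cl] := coarse_add cS sS vS sv ci cj.
apply: (IH (inr v |: S)); last by exists l.
- rewrite -ltnS; apply: leq_trans le; rewrite ltnS; apply: proper_card.
  apply/properP; split; first by rewrite setDS // subsetUr.
  by exists (inr v); rewrite !inE ?eqxx // vS.
- by rewrite subUset sub1set vF.
- by rewrite !inE v0S orbT.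
have to_s a : a \in inr v |: S -> connect (inside (inr v |: S)) a (inr s)
                               /\ connect (inside (inr v |: S)) (inr s) a.
  rewrite !inE => /predU1P[->|aS].
    by split; apply: connect1; rewrite /inside !inE eqxx sS ?orbT ?(adj_sym (inr v)) ?sv.
  have sub c d : inside S c d -> connect (inside (inr v |: S)) c d.
    by case/and3P=> cd cS' dS; rewrite connect1 //= /inside cd !inE cS' dS !orbT.
  by split; apply: (connect_homo (h := id) sub); apply: cS.
move=> c d /to_s[cs _] /to_s[_ sd]; exact: connect_trans cs sd.
Qed.
End Merge.
End StableTree.

(** * Existence of basic pairs *)

Section RootedTree.
Variables (V : finType) (p : V -> V) (r : V) (d : V -> nat).
Hypothesis p_lt : forall x, x != r -> d (p x) < d x.

(** The tree of a parent map [p] with root [r]; the value of [p] at [r] is ignored. The depth [d],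
    decreasing along [p], gives connectedness and excludes loops. *)
Definition parent_rel (x y : V) := (x != r) && (p x == y) || (y != r) && (p y == x).

Lemma parent_rel_sym : symmetric parent_rel.
Proof. by move=> x y; rewrite /parent_rel orbC. Qed.

Lemma parent_rel_irr x : ~~ parent_rel x x.
Proof.
rewrite /parent_rel orbb; apply/negP => /andP[/p_lt + /eqP px].
by rewrite px ltnn.
Qed.

Lemma parent_rel_connect x y : connect parent_rel x y.
Proof.
have to_r z : connect parent_rel z r.
  have [m le] := ubnP (d z); elim: m => // m IH in z le *.
  have [->|zr] := eqVneq z r; first exact: connect0.
  apply: connect_trans (connect1 _) (IH (p z) _).
    by rewrite /parent_rel zr eqxx.
  exact: leq_trans (p_lt zr) le.
apply: connect_trans (to_r x) _.
by rewrite (sym_connect_sym parent_rel_sym).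
Qed.

Lemma card_parent_rel :
  #|[set q : V * V | parent_rel q.1 q.2]| = (#|V| - 1).*2.
Proof.
pose up x := (x, p x); pose down x := (p x, x).
have -> : [set q | parent_rel q.1 q.2] = up @: [set~ r] :|: down @: [set~ r].
  apply/setP=> -[x y]; rewrite !inE /parent_rel /=; congr (_ || _).
    apply/andP/imsetP => [[xr /eqP<-]|[z]]; first by exists x; rewrite ?inE.
    by rewrite !inE => zr [-> ->].
  apply/andP/imsetP => [[xr /eqP<-]|[z]]; first by exists y; rewrite ?inE.
  by rewrite !inE => zr [-> ->].
rewrite cardsU !card_imset; [|by move=> x y []|by move=> x y []].
rewrite (_ : _ :&: _ = set0) ?cards0 ?subn0.
  by rewrite cardsC1 subn1 addnn.
(* A pair that is both an upward and a downward edge would have each end strictly deeper than the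
   other. *)
apply/setP=> -[x y]; rewrite !inE; apply/negP => /andP[].
case/imsetP=> a; rewrite !inE => /p_lt pa [-> ->].
case/imsetP=> b; rewrite !inE => /p_lt pb [ab ba].
rewrite ba ab in pa; by have := ltn_trans pa pb; rewrite ltnn.
Qed.
End RootedTree.

Lemma basic_pair_exists n (e : rel 'I_n) : equivalence_rel e -> three_classes e ->
  exists G c, @basic_pair n (part e) G c.
Proof.
move=> ee t3; pose cls i := [set y | e i y].
(* Index set of the internal vertices: [set0] stands for the centre, every other member for a block
   with at least two leaves. *)
pose T := set0 |: [set B in part e | 1 < #|B|].
have T0 : set0 \in T by rewrite !inE eqxx.
pose code := enum_rank_in T0; pose f (u : 'I_#|T|) := enum_val u.
have fK : cancel f code := enum_valK_in T0.
have codeK : {in T, cancel code f} := enum_rankK_in T0.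
pose c := code set0.
have fP u : u != c -> f u \in part e /\ 1 < #|f u|.
  move=> uc; have := enum_valP u; rewrite !inE => /orP[/eqP fu|/andP[]] //.
  by case/eqP: uc; rewrite -(fK u) /f fu.
have f_cls u i : u != c -> i \in f u -> f u = cls i.
  case/fP=> /partP[t ->] _; rewrite inE; exact: eqv_class.
(* The member of [T] whose vertex carries leaf [i]: its block, or the centre if that block is a
   singleton. *)
pose bb i := if 1 < #|cls i| then cls i else set0.
have bbT i : bb i \in T.
  by rewrite /bb; case: ifP => // h; rewrite !inE class_in_part h orbT.
have bbf i u : u != c -> (code (bb i) == u) = (i \in f u).
  move=> uc; apply/eqP/idP => [eu|iu].
    have fu : f u = bb i by rewrite -eu codeK.
    move: (fP u uc) => -[_]; rewrite fu /bb; case: ifP; rewrite ?cards0 //.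
    by rewrite inE eqv_refl.
  have [_ fu] := fP u uc.
  by rewrite -[RHS]fK (f_cls u i) // /bb -(f_cls u i) // fu.
have singl i : (1 < #|cls i|) = false -> cls i = [set i].
  move=> h; apply/eqP; rewrite eq_sym eqEcard cards1 leqNgt h andbT sub1set inE.
  exact: eqv_refl.
have bbc i : (code (bb i) == c) = ([set i] \in part e).
  apply/eqP/idP => [/(congr1 f)|/partP[t it]].
    rewrite !codeK // /bb; case: ifP => [h /setP/(_ i)|/singl <- _].
      by rewrite !inE eqv_refl.
    exact: class_in_part.
  have ti : e t i by move/setP/(_ i): it; rewrite !inE eqxx.
  by rewrite /bb /cls -(eqv_class ee ti) -it cards1.
pose W := vtx n #|T|.
pose p (x : W) : W := match x with inl i => inr (code (bb i)) | inr _ => inr c end.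
pose d (x : W) := match x with inl _ => 2 | inr u => nat_of_bool (u != c) end.
have pd x : x != inr c -> d (p x) < d x.
  case: x => [i|u] /=; first by case: eqP.
  by rewrite (inj_eq inr_inj) eqxx => ->.
pose G := STree (parent_rel p (inr c)).
have aii i j : adj G (inl i) (inl j) = false by rewrite /= /parent_rel.
have aiu i u : adj G (inl i) (inr u) = (code (bb i) == u).
  by rewrite /= /parent_rel /= (inj_eq inr_inj) andbF orbF.
have auu u u' : adj G (inr u) (inr u') =
    ((u == c) && (u' != c)) || ((u' == c) && (u != c)).
  by rewrite /= /parent_rel /= !(inj_eq inr_inj) !(eq_sym c) orbC
             ![(_ == c) && _]andbC.
have as_ x y : adj G x y = adj G y x by apply: parent_rel_sym.
exists G, c; split.
  split=> //; split; first exact: (parent_rel_irr pd).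
  split; first exact: (parent_rel_connect pd).
  split; first exact: (card_parent_rel pd).
  split=> [i|u].
    apply/eqP/cards1P; exists (inr (code (bb i))); apply/setP=> -[j|u].
      by rewrite !inE aii.
    by rewrite !inE aiu (inj_eq inr_inj) eq_sym.
  apply/card_gt2P; have [->|uc] := eqVneq u c; last first.
    have [i [j [iu ju ij]]] := card_gt1P (fP u uc).2.
    exists (inl i), (inl j), (inr c); rewrite !inE !(as_ (inr u)) !aiu !bbf // auu uc.
    by rewrite eqxx (inj_eq inl_inj).
  (* The neighbour of the centre in the direction of leaf [t]. Three inequivalent leaves give three
     distinct neighbours, so the centre has degree at least 3. *)
  pose nb t : W := if 1 < #|cls t| then inr (code (cls t)) else inl t.
  have clsT t : 1 < #|cls t| -> cls t \in T.
    by move=> h; rewrite !inE class_in_part h orbT.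
  have nbP t : nb t \in [set y | adj G (inr c) y].
    rewrite inE /nb; case: ifP => h; last first.
      by rewrite as_ aiu bbc -singl ?class_in_part.
    rewrite auu eqxx /=; suff -> : code (cls t) != c by [].
    apply/eqP => /(congr1 f); rewrite (codeK _ (clsT t h)) (codeK _ T0).
    by move/setP/(_ t); rewrite !inE eqv_refl.
  have nbI a b : ~~ e a b -> nb a != nb b.
    apply: contraNneq; rewrite /nb; case: ifP => ha; case: ifP => hb // [].
      move/(congr1 f); rewrite (codeK _ (clsT a ha)) (codeK _ (clsT b hb)).
      by move/setP/(_ b); rewrite !inE eqv_refl.
    by move->; rewrite (eqv_refl _ ee).
  have [x [y [z [xy yz zx]]]] := t3.
  by exists (nb x), (nb y), (nb z); split; split; rewrite ?nbP ?nbI.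
exists f; split=> //; split.
  by move=> u u' _ _ /(congr1 code); rewrite !fK.
split.
  move=> B BQ B2; exists (code B).
  have BT : B \in T by rewrite !inE BQ B2 orbT.
  rewrite codeK //; split=> //; apply/eqP => /(congr1 f); rewrite !codeK // => B0.
  by rewrite B0 cards0 in B2.
split; first by move=> i j; rewrite aii.
split; first by move=> i; rewrite aiu bbc.
by split=> // i u uc; rewrite aiu bbf.
Qed.

(** * Contraction onto a basic pair *)

Section CollapseToBasicPair.
Variables (n : nat) (H : stree n) (w : 'I_(nint H)) (P : {set {set 'I_n}}).
Hypotheses (hn : 3 <= n) (sH : stable H).
Local Notation e := (lcon (G := H) [set inr w]).
Local Notation Q := (part (shatter P e)).
Variables (G : stree n) (c : 'I_(nint G)).
Hypothesis bG : basic_pair Q G c.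
Local Notation g := (adj H).
Local Notation dw := (del g [set inr w]).

Let gs : symmetric g := adj_sym sH.

(** Each component of [H - w] whose leaves form an unshattered block of size at least 2 collapses to
    the vertex of that block; all other components collapse onto [w]. *)
Lemma basic_pair_contraction :
  exists pi : 'I_(nint H) -> 'I_(nint G), contraction H G pi /\ pi w = c.
Proof.
have [p hp] := leaf_parent hn sH.
have [_ [f [fP [finj [fsurj [aii [aic [aiu auu]]]]]]]] := bG.
have ee : equivalence_rel e := lcon_eqv sH _.
have sg : setpart Q := setpart_part (shatter_eqv P ee).
have dsym := del_connect_sym sH [set inr w].
pose Lf x := [set i | connect dw x (inl i)].
pose good x := ~~ (Lf x \subset singU P) && (1 < #|Lf x|).
(* The default [c] is never reached for a block of [Q] with two or more leaves. *)
pose code B := odflt c [pick u | (u != c) && (f u == B)].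
have codeP B : B \in Q -> 1 < #|B| -> code B != c /\ f (code B) = B.
  move=> BQ B2; rewrite /code; case: pickP => [u /andP[uc /eqP]//|no].
  by have [u [uc fu]] := fsurj B BQ B2; have := no u; rewrite uc fu eqxx.
(* Defined on leaves too, so that it is constant along every path of [H - w]. *)
pose epi x := if good x then code (Lf x) else c.
have LfE i : Lf (inl i) = [set y | e i y] by [].
have goodQ i : [set y | shatter P e i y] =
    if good (inl i) then Lf (inl i) else [set i].
  rewrite shatter_class // /good LfE; case: ifP => //= _.
  case: ltnP => // le1; apply/esym/eqP; rewrite eqEcard cards1 le1 andbT.
  by rewrite sub1set inE; apply: connect0.
have Lf_con x y : connect dw x y -> Lf x = Lf y.
  by move=> xy; apply/setP=> i; rewrite !inE (same_connect dsym xy).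
have epi_con x y : connect dw x y -> epi x = epi y.
  by move=> xy; rewrite /epi /good (Lf_con _ _ xy).
have goodP x : good x -> Lf x \in Q /\ 1 < #|Lf x|.
  move=> gx; have /andP[_ x2] := gx; split=> //.
  have /card_gt0P[i] := ltnW x2; rewrite inE => /Lf_con xi.
  have := class_in_part (shatter P e) i; rewrite goodQ.
  by rewrite /good -xi -/(good x) gx.
have epi_c x : (epi x == c) = ~~ good x.
  rewrite /epi; case: ifP => [gx|_]; last by rewrite eqxx.
  by have [/negPf->] := codeP _ (goodP x gx).1 (goodP x gx).2.
have f_epi x : good x -> f (epi x) = Lf x.
  by move=> gx; rewrite /epi gx; have [] := codeP _ (goodP x gx).1 (goodP x gx).2.
have isolated x : (forall y, ~~ dw x y) -> ~~ good x.
  move=> no; rewrite /good negb_and -leqNgt; apply/orP; right.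
  have con y : connect dw x y -> y = x.
    by case/connectP=> -[|z q] //= /andP[xz]; case/negP: (no z).
  apply/card_le1_eqP => i j; rewrite !inE => /con xi /con xj.
  by have [] : inl i = inl j :> vtx n (nint H) by rewrite xi xj.
have ngw : ~~ good (inr w) by apply: isolated => y; rewrite /= !inE eqxx andbF.
have par_dw i : p i != w -> dw (inl i) (inr (p i)).
  by move=> iw; rewrite /= hp !inE eqxx (inj_eq inr_inj) iw.
have ng_leaf i : p i = w -> ~~ good (inl i).
  move=> iw; apply: isolated => y; rewrite /= hp iw !inE.
  by case: eqP.
have epi_par i : epi (inr (p i)) = epi (inl i).
  have [iw|iw] := eqVneq (p i) w; last by apply/esym/epi_con/connect1/par_dw.
  by rewrite iw /epi (negPf ngw) (negPf (ng_leaf i iw)).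
pose pi u := epi (inr u).
have adj_iu i u : adj G (inl i) (inr u) = (u == epi (inl i)).
  have [->|uc] := eqVneq u c.
    rewrite aic eq_sym epi_c; apply/idP/idP => [iQ|ng].
      apply/negP => gi; have [LQ L2] := goodP _ gi.
      have iL : i \in Lf (inl i) by rewrite inE connect0.
      by rewrite (setpart_disjoint sg LQ iQ iL (set11 i)) cards1 in L2.
    by have := class_in_part (shatter P e) i; rewrite goodQ (negPf ng).
  have [fQ f2] := fP u uc; rewrite aiu //.
  have icls : i \in [set y | shatter P e i y].
    by rewrite inE; apply: eqv_refl; apply: shatter_eqv.
  have clsQ := class_in_part (shatter P e) i.
  apply/idP/eqP => [iu|eu].
    have := setpart_disjoint sg fQ clsQ iu icls.
    rewrite goodQ; case: ifP => gi fE; last by rewrite fE cards1 in f2.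
    by apply: finj; rewrite ?epi_c ?gi // f_epi.
  rewrite eu epi_c negbK in uc.
  by rewrite eu f_epi // inE connect0.
have reach x : x != inr w -> exists2 y, connect dw x y & g y (inr w).
  move=> xw; pose S := [set y | connect dw x y].
  have wS : inr w \notin S.
    rewrite inE dsym; apply: contraNN xw => /connect_del_in -> //.
    exact: set11.
  have xS : x \in S by rewrite inE connect0.
  have [a [b [ab aS bS]]] := exit_edge (adj_connect sH x (inr w)) xS wS.
  rewrite !inE in aS bS; exists a => //.
  have [<-//|bw] := eqVneq b (inr w); case/negP: bS.
  apply: connect_trans (aS) (connect1 _); rewrite /= ab !inE bw andbT.
  by apply: contraNneq wS => ea; rewrite inE -[X in connect _ _ X]ea.
have surj u : exists v, pi v = u.
  have [->|uc] := eqVneq u c.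
    by exists w; apply/eqP; rewrite epi_c.
  have [fQ f2] := fP u uc.
  have /card_gt0P[i iu] := ltnW f2.
  by exists (p i); apply/esym/eqP; rewrite /pi epi_par -adj_iu aiu.
(* Moving each leaf to its parent turns a path of [H - w] into one through internal vertices only,
   all in one fibre. *)
pose h (x : vtx n (nint H)) := match x with inl i => p i | inr u => u end.
pose fib := [rel a b | g (inr a) (inr b) && (pi a == pi b)].
have dw_fib x y : connect dw x y -> connect fib (h x) (h y).
  apply: connect_homo => {}x {}y xy; have /and3P[gxy _ _] := xy.
  case: x y xy gxy => [i|a] [j|b] xy.
  - by rewrite hp.
  - by rewrite hp => /eqP[->]; apply: connect0.
  - by rewrite gs hp => /eqP[->]; apply: connect0.
  - by move=> ab; rewrite connect1 //= ab /pi (epi_con _ _ (connect1 xy)) eqxx.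
exists pi; split; last by apply/eqP; rewrite epi_c.
split=> //; split.
  have fsym : connect_sym fib.
    by apply: sym_connect_sym => a b /=; rewrite gs eq_sym.
  move=> u u' eu; have [cu|ncu] := eqVneq (pi u) c; last first.
    (* Away from [c], two vertices with the same image see the same nonempty set of leaves, so they
       lie in one component of [H - w]. *)
    have gu : good (inr u) by rewrite epi_c negbK in ncu.
    have gu' : good (inr u') by rewrite eu epi_c negbK in ncu.
    have eL : Lf (inr u) = Lf (inr u') by rewrite -!f_epi // -/(pi u) eu.
    have /card_gt0P[i iu] := ltnW (goodP _ gu).2.
    have iu' := iu; rewrite eL in iu'; rewrite !inE in iu iu'.
    by apply: (dw_fib (inr u) (inr u')); apply: connect_trans iu _; rewrite dsym.
  (* The component of [v] contains a neighbour of [w] and lies entirely over [c], as does [w]. *)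
  have to_w v : pi v = c -> connect fib v w.
    move=> cv; have [->|vw] := eqVneq v w; first exact: connect0.
    have [y vy yw] := reach (inr v) (contra_neq (@inr_inj _ _ _ _) vw).
    apply: connect_trans (dw_fib _ _ vy) _.
    case: y vy yw => [i _|b vb bw] /=; first by rewrite hp => /eqP[<-]; apply: connect0.
    rewrite connect1 //= bw /pi -(epi_con _ _ vb) -/(pi v) cv eq_sym.
    by rewrite epi_c.
  by apply: connect_trans (to_w u cu) _; rewrite fsym to_w // -eu.
have iu_edge i u : adj G (inl i) (inr u) <->
    exists a b, extv pi a = inl i /\ extv pi b = inr u /\ g a b.
  rewrite adj_iu -epi_par; split=> [/eqP->|].
    by exists (inl i), (inr (p i)); rewrite hp.
  case=> a [b [+ []]]; case: a => // a [->]; case: b => // b [<-].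
  by rewrite hp => /eqP[->].
have c_edge u : u != c ->
    exists a b, extv pi a = inr c /\ extv pi b = inr u /\ g a b.
  move=> uc; have [v vu] := surj u.
  have gv : good (inr v) by move: uc; rewrite -vu epi_c negbK.
  have vw : inr v != inr w :> vtx n (nint H).
    by apply: contraTneq gv => ->.
  have [y vy yw] := reach _ vw; case: y vy yw => [i|b] vb; rewrite gs => wb.
    rewrite gs hp in wb; have /eqP[/esym iw] := wb.
    by have := ng_leaf i iw; rewrite /good -(Lf_con _ _ vb) -/(good _) gv.
  exists (inr w), (inr b); split.
    by congr inr; apply/eqP; rewrite epi_c.
  by split=> //; congr inr; rewrite /pi -(epi_con _ _ vb).
move=> x y; case: x => [i|u]; case: y => [j|u'] xy.
- rewrite (negPf (aii i j)); split=> // -[a [b [+ []]]].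
  by case: a => // a _; case: b => // b _; rewrite hp.
- exact: iu_edge.
- have swap : (exists a b, extv pi a = inl j /\ extv pi b = inr u /\ g a b) <->
     (exists a b, extv pi a = inr u /\ extv pi b = inl j /\ g a b).
    by split=> -[a [b [ha [hb ab]]]]; exists b, a; rewrite gs.
  have [asym _] := bG.1.
  by rewrite asym; apply: iff_trans (iu_edge j u) swap.
rewrite (inj_eq inr_inj) in xy; rewrite auu; split.
  case/orP=> /andP[/eqP-> uc]; first exact: c_edge.
  have [a [b [ha [hb ab]]]] := c_edge _ uc.
  by exists b, a; rewrite gs.
case=> a [b [+ []]]; case: a => // a [au]; case: b => // b [bu] ab.
(* An edge avoiding [w] stays in one component, where [pi] is constant; an edge between distinct
   fibres therefore ends at [w]. *)
have [aw|aw] := eqVneq a w.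
  have uc : u = c by rewrite -au aw; apply/eqP; rewrite epi_c.
  by rewrite -uc eqxx eq_sym xy.
have [bw|bw] := eqVneq b w.
  have uc : u' = c by rewrite -bu bw; apply/eqP; rewrite epi_c.
  by rewrite -uc eqxx xy orbT.
case/eqP: xy; rewrite -au -bu; apply: epi_con; apply: connect1.
by rewrite /= ab !inE !(inj_eq inr_inj) aw bw.
Qed.
End CollapseToBasicPair.

(** * Atomic assignments as down-sets of partitions *)

Section Contraction.
Variables (n : nat) (G G' : stree n) (pi : 'I_(nint G) -> 'I_(nint G')).
Hypothesis cpi : contraction G G' pi.

Definition fibre w := [set x : vtx n (nint G) | extv pi x == inr w].

Lemma fibre_connect (r : rel (vtx n (nint G))) x y :
  (forall a b, adj G a b -> extv pi a = extv pi x -> extv pi b = extv pi x -> r a b) ->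
  extv pi x = extv pi y -> connect r x y.
Proof.
have [_ [conn _]] := cpi.
move=> hr; case: x y hr => [x|u] [y|v] //= hr; first by case=> ->; apply: connect0.
case=> /conn uv; pose s a b := adj G (inr a) (inr b) && (pi a == pi b).
have inv t : connect s u t -> pi t = pi u.
  move=> ut; apply/eqP; apply: (connect_inv (p := fun t => pi t == pi u) _ ut) => //.
  by move=> a b /andP[_ /eqP->].
apply: (connect_homo (h := inr) _ (connect_restrict (r' := fun a b =>
  r (inr a) (inr b)) _ uv)) => a b; first exact: connect1.
move=> /inv ua /inv ub /andP[/= ab _].
by apply: hr; rewrite //= ?ua ?ub.
Qed.

(** Paths project along [pi]. Conversely each edge of a path in [G'] lifts to an edge of [G], and
    the gaps between consecutive lifts are bridged inside fibres, which are connected. *)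
Lemma lcon_contraction w :
  lcon (G := G') [set inr w] =2 lcon (fibre w).
Proof.
have [surj [_ edge]] := cpi; move=> i j.
apply/idP/idP; last first.
  apply: (connect_homo (h := extv pi)) => a b /and3P[ab]; rewrite !inE => aw bw.
  have [->|nab] := eqVneq (extv pi a) (extv pi b); first exact: connect0.
  rewrite connect1 //= !inE aw bw !andbT.
  by apply/edge => //; exists a, b.
have lift x y a : connect (del (adj G') [set inr w]) x y -> x != inr w ->
    extv pi a = x -> exists2 b, extv pi b = y & connect (del (adj G) (fibre w)) a b.
  case/connectP=> q qP ->{y} xw; elim: q x a qP xw => [|z q IH] x a /=.
    by move=> _ _ ax; exists a => //; apply: connect0.
  case/andP=> /and3P[xz]; rewrite !inE => xw zw zq _ ax.
  (* [contraction] says nothing about loops of [G'], so a step with equal ends is skipped. *)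
  have [xz_eq|nxz] := eqVneq x z.
    by apply: (IH z a) => //; rewrite ax.
  have [a' [b' [a'x [b'z ab']]]] := (edge _ _ nxz).1 xz.
  have [b bq zb] := IH z b' zq zw b'z; exists b => //.
  apply: (connect_trans (y := a')).
    apply: fibre_connect; last by rewrite ax a'x.
    by move=> s t st sx tx; rewrite /= st !inE sx tx ax xw.
  apply: connect_trans zb; apply: connect1.
  by rewrite /= ab' !inE a'x b'z xw zw.
by case/(lift _ _ (inl i)) => // -[b|//] [->].
Qed.
End Contraction.

Lemma coarse_sub n (e e' : rel 'I_n) P : subrel e e' -> coarse e P -> coarse e' P.
Proof. by move=> se c B x y BP xB yB; apply: se; apply: c BP xB yB. Qed.

Lemma basic_pair_coarse n (Q : {set {set 'I_n}}) (G : stree n) c :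
  basic_pair Q G c -> coarse (lcon (G := G) [set inr c]) Q.
Proof.
case=> sG [f [fP [_ [fsurj [_ [_ [aiu _]]]]]]] B x y BQ xB yB.
have [->|xy] := eqVneq x y; first exact: connect0.
have [|u [uc fu]] := fsurj B BQ; first by apply/card_gt1P; exists x, y.
have del_iu z : z \in B -> del (adj G) [set inr c] (inl z) (inr u).
  by move=> zB; rewrite /= aiu // fu zB !inE (inj_eq inr_inj) uc.
apply: connect_trans (connect1 (del_iu x xB)) _.
by rewrite (del_connect_sym sG) connect1 // del_iu.
Qed.

(** Forward, the fibre over the centre of the basic pair contains [w], so leaves connected off that
    fibre are connected off [w]. Backward, the witness is the shattered partition, onto whose basic
    pair [H] contracts. *)
Lemma atomicP n (H : stree n) (w : 'I_(nint H)) (P : {set {set 'I_n}}) :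
  3 <= n -> stable H -> setpart P ->
  atomic P H w <-> coarse (lcon (G := H) [set inr w]) P.
Proof.
move=> hn sH sP; set e := lcon _; have ee : equivalence_rel e := lcon_eqv sH _.
split=> [[Q [sQ [/andP[QP _] [_ [G [c [bG [pi [cpi piw]]]]]]]]]|ce].
  move=> B x y BP xB yB; have /exists_inP[C CQ /subsetP BC] := forall_inP QP B BP.
  have := basic_pair_coarse bG CQ (BC x xB) (BC y yB).
  rewrite (lcon_contraction cpi); apply: lcon_sub.
  by rewrite sub1set inE /= piw.
have t3 : three_classes (shatter P e).
  by apply: three_classes_sub (shatter_sub ee) (lcon_three_classes sH (set11 _)).
have se := shatter_eqv P ee.
exists (part (shatter P e)); split; first exact: setpart_part.
split; first exact: pprec_shatter.
split; first exact: card_part.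
have [G [c bG]] := basic_pair_exists se t3; exists G, c; split=> //.
refine (basic_pair_contraction hn sH bG).
Qed.

(** * Conditions (a) and (b) for the union *)

Theorem theorem6p9 (n k : nat) (P : 'I_k -> {set {set 'I_n}})
  (hn : 3 <= n)
  (hP : forall i, setpart (P i))
  (hsz : forall i, 3 <= #|P i| <= n.-1)
  (hinc : forall i j, i != j -> ~~ ple (P i) (P j))
  (htub : forall i j, i != j ->
     forall Qi Qj : {set {set 'I_n}},
       setpart Qi -> setpart Qj -> pprec Qi (P i) -> pprec Qj (P j) ->
       3 <= #|Qi| -> 3 <= #|Qj| ->
       forall R, setpart R -> tight_ub Qi Qj R -> exists l, ple R (P l)) :
  extremal (fun (G : stree n) (w : 'I_(nint G)) => exists i, atomic (P i) G w).
Proof.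
have Zcoarse (G : stree n) w : stable G -> (exists i, atomic (P i) G w) <->
    exists i, coarse (lcon (G := G) [set inr w]) (P i).
  by move=> sG; split=> -[i ci]; exists i; apply/(atomicP w hn sG (hP i)).
split=> [G sG allZ|G G' pi sG sG' cpi w].
  have [p hp] := leaf_parent hn sG.
  pose F := [set x : vtx n (nint G) | if x is inr _ then true else false].
  pose h (x : vtx n (nint G)) := match x with inl i => inr (p i) | inr u => x end.
  have cF : connected_set F.
    move=> [i|u] [j|v]; rewrite !inE // => _ _.
    apply: (connect_homo (h := h)) (adj_connect sG (inr u) (inr v)).
    move=> [i|a] [j|b].
    - by rewrite hp.
    - by rewrite hp => /eqP->; apply: connect0.
    - by rewrite (adj_sym sG) hp => /eqP->; apply: connect0.
    - by move=> ab; rewrite connect1 // /inside ab !inE.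
  have [||v _|l cl] := coarse_connected (F := F) (v0 := p (Ordinal (ltnW (ltnW hn))))
    sG hP htub cF.
  - by rewrite inE.
  - by move=> i; rewrite inE.
  - exact/(Zcoarse G v sG).
  (* With all internal vertices deleted every leaf is isolated, so the blocks of [P l] are
     singletons; this gives at least [n] blocks, one too many. *)
  have disc B x y : B \in P l -> x \in B -> y \in B -> x = y.
    move=> BP xB yB; have := cl B x y BP xB yB.
    case/connectP=> -[|z q] /=; first by move=> _ [].
    by rewrite hp; case/andP=> /and3P[/eqP-> _]; rewrite inE.
  have /andP[_] := hsz l; rewrite leqNgt => /negP[].
  have /and3P[/eqP Pcov Ptriv P0] := hP l.
  rewrite prednK ?(ltnW (ltnW hn)) //.
  have inj : injective (pblock (P l)).
    move=> x y exy; have xc z : z \in cover (P l) by rewrite Pcov inE.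
    apply: (disc (pblock (P l) x)); rewrite ?pblock_mem ?mem_pblock //.
    by rewrite exy mem_pblock.
  rewrite -[X in X <= _]card_ord -(card_imset _ inj); apply: subset_leq_card.
  by apply/subsetP=> B /imsetP[x _ ->]; rewrite pblock_mem // Pcov inE.
apply: (iff_trans (Zcoarse G' w sG')); split=> [[i ci] v pv|hv].
  apply/(Zcoarse G v sG); exists i; apply: coarse_sub ci => x y.
  rewrite (lcon_contraction cpi); apply: lcon_sub.
  by rewrite sub1set inE /= pv.
(* The converse applies [coarse_connected] to the fibre over [w], where the index [i] may vary from
   vertex to vertex. *)
have [surj _] := cpi; have [v0 pv0] := surj w.
have [||||l cl] := coarse_connected (F := fibre pi w) (v0 := v0) sG hP htub.
- move=> x y; rewrite !inE => /eqP xw /eqP yw.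
  apply: (fibre_connect cpi); last by rewrite xw yw.
  by move=> a b ab aw bw; rewrite /inside ab !inE aw bw xw eqxx.
- by rewrite inE /= pv0.
- by move=> i; rewrite inE.
- move=> v; rewrite inE => /eqP[pv]; apply/(Zcoarse G v sG); exact: hv.
exists l; apply: coarse_sub cl => x y.
by rewrite (lcon_contraction cpi).
Qed.
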